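(* Let $(G,\nu)$ be a computable group. The set of all effective F\o lner sequences of $(G,\nu)$ belongs to the class $\Pi^0_3$. Moreover, for $G=\bigoplus_{n\in\omega}\mathbb{Z}$ (with its standard computable presentation) it is a $\Pi^0_3$-complete set.
   Context: A numbered group is a pair $(G,\nu)$ with $G$ a countable group and $\nu:\mathbb{N}\to G$ a surjection. It is computable if $\{(i,j,k)\in\mathbb{N}^3:\nu(i)\nu(j)=\nu(k)\}$ is a computable (decidable) set. For computable groups it is assumed here that $\nu$ is one-to-one, and $G$ is identified with $\mathbb{N}$ via $\nu$, so that finite subsets of $G$ have G\''odel numbers (canonical indices). A F\o lner sequence of $G$ is a sequence $(F_j)_{j\in\mathbb{N}}$ of non-empty finite subsets of $G$ such that for every $g\in G$, $\lim_{j\to\infty}\frac{|F_j\setminus gF_j|}{|F_j|}=0$. An effective F\o lner sequence of $(G,\nu)$ is a sequence $(n_j)_{j\in\mathbb{N}}$ of natural numbers such that $j\mapsto n_j$ is recursive, each $n_j$ is the G\''odel number of a finite set $F_j$, and $(F_j)_{j\in\mathbb{N}}$ is a F\o lner sequence. Effective F\o lner sequences are identified with the numbers of the recursive functions producing them: fixing a universal partial recursive function $\varphi(x,y)$ and $\varphi_x(y)=\varphi(x,y)$, the set of all effective F\o lner sequences of $(G,\nu)$ is the set of all $m\in\mathbb{N}$ such that $\varphi_m$ is total and $(\varphi_m(j))_{j\in\mathbb{N}}$ is an effective F\o lner sequence of $(G,\nu)$. $\Pi^0_3$-completeness is with respect to many-one reducibility. The standard computable presentation of $\bigoplus_{n\in\omega}\mathbb{Z}=\bigoplus_{n\in\omega}\langle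 g_n\rangle$ is the one given by a computable bijective coding by natural numbers of finitely supported integer sequences, so that in particular $n\mapsto g_n$ is computable. *)

(* Defs.v *)
From HB Require Import structures.
From mathcomp Require Import all_boot all_order all_algebra.
From mathcomp Require Import finmap.
From mathcomp.multinomials Require Import monalg.
From mathcomp Require Import all_classical all_reals all_analysis.

Set Implicit Arguments.
Unset Strict Implicit.
Unset Printing Implicit Defensive.

Import Order.TTheory GRing.Theory Num.Theory.
Import numFieldNormedType.Exports.

Local Open Scope classical_set_scope.
Local Open Scope ring_scope.

(* Kleene's schemes for the partial recursive functions of k variables. *)
Inductive recalg : nat -> Type :=
| Rzero k : recalg k
| Rsucc : recalg 1
| Rproj k : 'I_k -> recalg k
| Rcomp k n : recalg k -> ('I_k -> recalg n) -> recalg n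
| Rprec k : recalg k -> recalg k.+2 -> recalg k.+1
| Rmin k : recalg k.+1 -> recalg k.

(* [sem c v y] is the graph relation: c halts on v with value y.  The schemes
   of primitive recursion and minimization use the first argument:
     h (0, v) = f v,  h (i.+1, v) = g (i, h (i, v), v);
     y = least i with f (i, v) = 0, all f (i', v) for i' < i being defined. *)
Fixpoint sem k (c : recalg k) : k.-tuple nat -> nat -> Prop :=
  match c in recalg k return k.-tuple nat -> nat -> Prop with
  | Rzero _ => fun v y => y = 0%N
  | Rsucc => fun v y => y = (thead v).+1
  | Rproj _ i => fun v y => y = tnth v i
  | Rcomp _ _ f g => fun v y =>
      exists2 w, forall i, sem (g i) v (tnth w i) & sem f w y
  | Rprec _ f g => fun v y =>
      exists h : nat -> nat,
        [/\ sem f [tuple of behead v] (h 0%N),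
            forall i, (i < thead v)%N ->
              sem g [tuple of i :: h i :: behead v] (h i.+1)
          & y = h (thead v)]
  | Rmin _ f => fun v y =>
      sem f [tuple of y :: v] 0%N /\
      forall i, (i < y)%N -> exists z, sem f [tuple of i :: v] z.+1
  end.

Definition partial_recursive k (f : k.-tuple nat -> option nat) :=
  exists c : recalg k, forall v y, sem c v y <-> f v = Some y.

Definition recursive k (f : k.-tuple nat -> nat) :=
  partial_recursive (fun v => Some (f v)).

Definition recursive1 (f : nat -> nat) :=
  recursive (fun v : 1.-tuple nat => f [tnth v 0]).

Definition partial_recursive2 (f : nat -> nat -> option nat) :=
  partial_recursive (fun v : 2.-tuple nat => f [tnth v 0] [tnth v 1]).

Definition computable_set k (A : set (k.-tuple nat)) :=
  exists2 chi : k.-tuple nat -> bool,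
    recursive (fun v => chi v : nat) & forall v, A v <-> chi v.

(* Universality in the sense of Goedel numberings: every partial recursive
   psi is obtained from phi by an effective change of index.  In particular
   every unary partial recursive function is some [phi x]; the mere
   enumeration property would also admit Friedberg numberings. *)
Definition universal (phi : nat -> nat -> option nat) :=
  partial_recursive2 phi /\
  forall psi, partial_recursive2 psi ->
    exists2 s, recursive1 s & forall x y, phi (s x) y = psi x y.

Definition Pi03 (A : set nat) :=
  exists2 P : set (4.-tuple nat), computable_set P &
    forall m, A m <-> forall a, exists b, forall c, P [tuple m; a; b; c].

Definition many_one_reducible (A B : set nat) :=
  exists2 f, recursive1 f & forall x, A x <-> B (f x).

Definition Pi03_complete (B : set nat) :=
  Pi03 B /\ forall A, Pi03 A -> many_one_reducible A B.

Definition computable_group (G : groupType) (nu : nat -> G) :=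
  [/\ forall g, exists n, nu n = g,
      injective nu
    & computable_set [set v : 3.-tuple nat |
        (nu [tnth v 0%N] * nu [tnth v 1%N])%g = nu [tnth v 2%N]]].

Definition folner (R : realType) (G : groupType) (F : nat -> {fset G}) :=
  (forall j, F j != fset0) /\
  forall g : G,
    (fun j => #|` (F j `\` [fset (g * x)%g | x in F j])%fset|%:R
              / #|` F j|%:R : R) @ \oo --> (0 : R).

Definition canonical_index (A : {fset nat}) : nat := (\sum_(x <- A) 2 ^ x)%N.

Definition effective_folner (R : realType) (G : groupType) (nu : nat -> G)
    (n : nat -> nat) :=
  recursive1 n /\
  exists2 F : nat -> {fset nat}, forall j, n j = canonical_index (F j) &
    folner R (fun j => [fset nu x | x in F j]%fset).

Definition effective_folner_indices (R : realType) (G : groupType)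
    (nu : nat -> G) (phi : nat -> nat -> option nat) : set nat :=
  [set m | exists2 n : nat -> nat, forall j, phi m j = Some (n j) &
     effective_folner R nu n].

(* Finitely supported functions nat -> int under pointwise addition, written
   multiplicatively. *)
Definition dirsumZ : groupType := Algebra.to_multiplicative {malg int[nat]}.

Definition dirsumZ_gen (n : nat) : dirsumZ := << n >> : {malg int[nat]}.

(* The bijective codings making the group operation and n |-> g_n computable;
   any two of them differ by a recursive permutation of nat. *)
Definition standard_presentation (nu : nat -> dirsumZ) :=
  computable_group nu /\
  exists2 s, recursive1 s & forall n, nu (s n) = dirsumZ_gen n.

(* Main.v *)
Require Import Defs.
From mathcomp Require Import all_boot all_order all_algebra.
From mathcomp Require Import finmap.
From mathcomp.multinomials Require Import monalg.
From mathcomp Require Import all_classical all_reals all_analysis.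
From mathcomp Require Import zify.

(* A finite set F is counted as nearly invariant under g through its defect
   |{x in F : g x notin F}| = |F \ g F|, which is computable from g and a
   canonical index of F.  Hence phi_m is an effective Foelner sequence iff for
   all a there is b such that phi_m(j) halts within b steps on a non-empty set
   for j <= a, and every value phi_m(j) with j >= b has defect at most
   |F_j| / (a + 1) with respect to the first a + 1 elements of the group.

   For hardness, let m in A iff forall a, exists b, forall c, Q(m, a, b, c).  The
   least candidate b <= j not yet refuted by some c <= j is nondecreasing in j,
   and it stabilizes iff some b is correct.  Let F_j be the box spanned by the
   first j generators whose side in direction a is 1 when the candidate for a
   changes at stage j and j + 1 otherwise.  The defect of F_j with respect to
   the generator g_a is at most |F_j| divided by that side, and is |F_j| when the
   side is 1; so F_j is a Foelner sequence iff every candidate stabilizes. *)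

Set Implicit Arguments.
Unset Strict Implicit.
Unset Printing Implicit Defensive.

Local Notation "s # i" := (nth 0%N s i) (at level 8, i at level 0, format "s # i").

(** * Recursive functions on lists of arguments *)

(** Functions of lists rather than tuples, so that arguments can be pushed and dropped without
    casts; only lists of length [k] matter. *)
Definition rec k (f : seq nat -> nat) :=
  exists c : recalg k, forall (v : k.-tuple nat) y, sem c v y <-> f v = y.

Lemma eq_rec k f g : (forall s, size s = k -> f s = g s) -> rec k f -> rec k g.
Proof.
by move=> fg [c cP]; exists c => v y; rewrite cP fg ?size_tuple.
Qed.

Lemma rec_nth k i : i < k -> rec k (fun s => s#i).
Proof.
by move=> ik; exists (Rproj (Ordinal ik)) => v y /=; rewrite (tnth_nth 0); split.
Qed.

Lemma rec_comp n k f (a : seq nat -> seq nat) :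
  (forall s, size s = n -> size (a s) = k) ->
  (forall i, i < k -> rec n (fun s => (a s)#i)) -> rec k f -> rec n (f \o a).
Proof.
move=> sa ra [c cP].
have /choice[d dP] (i : 'I_k) := ra i (ltn_ord i).
exists (Rcomp c d) => v y /=; have av := sa _ (size_tuple v).
have -> : a v = tcast av (in_tuple (a v)) by rewrite val_tcast.
split=> [[w aw /cP <-]|<-].
  congr f; apply: (@eq_from_nth _ 0) => [|i]; rewrite !size_tuple// => ik.
  have /dP := aw (Ordinal ik).
  by rewrite (tnth_nth 0)/= => <-; rewrite val_tcast.
exists (tcast av (in_tuple (a v))); last exact/cP.
by move=> i; apply/dP; rewrite (tnth_nth 0) val_tcast.
Qed.

Lemma rec_cons k f n :
  rec k.+1 f -> rec k n -> rec k (fun s => f (n s :: s)).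
Proof.
move=> rf rn; apply: (rec_comp (a := fun s => n s :: s)) rf => [s <-|[|i]] //.
exact: (@rec_nth k i).
Qed.

Lemma rec_shift k f : rec k f -> rec k.+1 (fun s => f (behead s)).
Proof.
apply: (rec_comp (a := behead)) => [s|i ik]; first by rewrite size_behead => ->.
by apply: eq_rec (rec_nth (ik : i.+1 < k.+1)) => s; rewrite nth_behead.
Qed.

(** The body of a recursion sees the index, the accumulator and then the parameters; this drops the
    accumulator. *)
Lemma rec_skip k f :
  rec k.+1 f -> rec k.+2 (fun s => f (s#0 :: behead (behead s))).
Proof.
apply: (rec_comp (a := fun s => s#0 :: behead (behead s))) => [s|[|i] ik].
- by rewrite /= !size_behead => ->.
- exact: (@rec_nth k.+2 0).
by apply: eq_rec (rec_nth (ik : i.+2 < k.+2)) => s; rewrite /= !nth_behead.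
Qed.

Lemma rec_app1 k (f : nat -> nat) a :
  rec 1 (fun s => f s#0) -> rec k a -> rec k (fun s => f (a s)).
Proof.
move=> rf ra; apply: (rec_comp (a := fun s => [:: a s])) rf => // i.
by rewrite ltnS leqn0 => /eqP->.
Qed.

Lemma rec_app2 k (f : nat -> nat -> nat) a b :
  rec 2 (fun s => f s#0 s#1) -> rec k a -> rec k b ->
  rec k (fun s => f (a s) (b s)).
Proof.
move=> rf ra rb; apply: (rec_comp (a := fun s => [:: a s; b s])) rf => //.
by case=> [|[|[]]].
Qed.

Lemma rec_app3 k (f : nat -> nat -> nat -> nat) a b c :
  rec 3 (fun s => f s#0 s#1 s#2) -> rec k a -> rec k b -> rec k c ->
  rec k (fun s => f (a s) (b s) (c s)).
Proof.
move=> rf ra rb rc.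
apply: (rec_comp (a := fun s => [:: a s; b s; c s])) rf => //.
by case=> [|[|[|[]]]].
Qed.

Lemma rec_app4 k (f : nat -> nat -> nat -> nat -> nat) a b c d :
  rec 4 (fun s => f s#0 s#1 s#2 s#3) ->
  rec k a -> rec k b -> rec k c -> rec k d ->
  rec k (fun s => f (a s) (b s) (c s) (d s)).
Proof.
move=> rf ra rb rc rd.
apply: (rec_comp (a := fun s => [:: a s; b s; c s; d s])) rf => //.
by case=> [|[|[|[|[]]]]].
Qed.

Definition prim (a : nat) (g : nat -> nat -> nat) (n : nat) : nat :=
  nat_rect (fun=> nat) a g n.

Lemma primS a g n : prim a g n.+1 = g n (prim a g n).
Proof. by []. Qed.

(** [Rprec] recurses on its first argument, so the bound [n s] is pushed in front of the parameters
    by [rec_cons]. *)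
Lemma rec_prim k a (g : nat -> nat -> seq nat -> nat) n :
  rec k a -> rec k.+2 (fun w => g w#0 w#1 (behead (behead w))) -> rec k n ->
  rec k (fun s => prim (a s) (fun i x => g i x s) (n s)).
Proof.
move=> [c cP] [d dP].
apply: (@rec_cons k (fun w =>
  prim (a (behead w)) (fun i x => g i x (behead w)) w#0)).
exists (Rprec c d) => v y /=; have -> : thead v = v#0 by rewrite /thead (tnth_nth 0).
split=> [[h [/cP h0 hS ->]]|<-].
  (* The witness [h] of [sem] is constrained only up to [v#0], hence the bounded induction. *)
  have : forall i, i <= v#0 -> prim (a (behead v)) (fun i x => g i x (behead v)) i = h i.
    elim=> [|i IH] iv //=; rewrite -/(prim _ _ _) IH ?(ltnW iv)//.
    by have /dP := hS _ iv.
  exact.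
exists (prim (a (behead v)) (fun i x => g i x (behead v))).
by split=> // [|i _]; [apply/cP|apply/dP].
Qed.

(** As [p] is total, the condition of [Rmin] on earlier arguments reduces to [p] being nonzero
    there. *)
Lemma rec_least k (p m : seq nat -> nat) : rec k.+1 p ->
  (forall s, size s = k -> p (m s :: s) = 0 /\ forall i, i < m s -> p (i :: s) <> 0) ->
  rec k m.
Proof.
move=> [c cP] pm; exists (Rmin c) => v y /=.
have [pm0 pmi] := pm _ (size_tuple v); split=> [[/cP/= py yi]|<-].
  have [ym|my|//] := ltngtP (m v) y; last by case: (pmi _ my).
  by have [z /cP/=] := yi _ ym; rewrite pm0.
split=> [|i im]; first exact/cP.
by exists (p (i :: v)).-1; apply/cP; rewrite /= prednK ?lt0n//; apply/eqP/pmi.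
Qed.

(** * Closure under arithmetic, bounded sums, bounded quantifiers and bounded search *)

Lemma rec_const k n : rec k (fun=> n).
Proof.
elim: n => [|n rn]; first by exists (Rzero k) => v y; split => /= ->.
apply: (@rec_app1 _ succn) rn.
by exists Rsucc => v y; rewrite /= /thead (tnth_nth 0); split=> ->.
Qed.

Lemma rec_succ k a : rec k a -> rec k (fun s => (a s).+1).
Proof.
apply: (@rec_app1 _ succn).
by exists Rsucc => v y; rewrite /= /thead (tnth_nth 0); split=> ->.
Qed.

Lemma rec_behead k i : i.+1 < k -> rec k (fun s => (behead s)#i).
Proof. by move=> /rec_nth; apply: eq_rec => s; rewrite nth_behead. Qed.

Lemma rec_behead2 k i : i.+2 < k -> rec k (fun s => (behead (behead s))#i).
Proof. by move=> /rec_nth; apply: eq_rec => s; rewrite !nth_behead. Qed.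

Lemma rec_pred k a : rec k a -> rec k (fun s => (a s).-1).
Proof.
move=> ra; have := rec_nth (isT : 0 < k.+2).
move=> /(rec_prim (g := fun i _ _ => i) (rec_const k 0))/(_ ra).
by apply: eq_rec => s _; case: (a s).
Qed.

Lemma rec_add k a b : rec k a -> rec k b -> rec k (fun s => a s + b s).
Proof.
move=> ra rb; have := rec_succ (rec_nth (isT : 1 < k.+2)).
move=> /(rec_prim (g := fun _ x _ => x.+1) ra)/(_ rb).
by apply: eq_rec => s _; elim: (b s) => [|n IH]; rewrite ?addn0// addnS -IH.
Qed.

Lemma rec_sub k a b : rec k a -> rec k b -> rec k (fun s => a s - b s).
Proof.
move=> ra rb; have := rec_pred (rec_nth (isT : 1 < k.+2)).
move=> /(rec_prim (g := fun _ x _ => x.-1) ra)/(_ rb).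
by apply: eq_rec => s _; elim: (b s) => [|n IH]; rewrite ?subn0// subnS -IH.
Qed.

Lemma rec_mul k a b : rec k a -> rec k b -> rec k (fun s => a s * b s).
Proof.
move=> ra rb.
have rg : rec k.+2 (fun w => w#1 + a (behead (behead w))).
  exact: rec_add (rec_nth _) (rec_shift (rec_shift ra)).
have := rec_prim (g := fun i x s => x + a s) (rec_const k 0) rg rb.
by apply: eq_rec => s _; elim: (b s) => [|n IH]; rewrite ?muln0// mulnSr -IH.
Qed.

Lemma rec_sum k n (f : nat -> seq nat -> nat) :
  rec k n -> rec k.+1 (fun w => f w#0 (behead w)) ->
  rec k (fun s => \sum_(0 <= i < n s) f i s).
Proof.
move=> rn rf.
have rg := rec_add (rec_nth (isT : 1 < k.+2)) (rec_skip rf).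
have := rec_prim (g := fun i x s => x + f i s) (rec_const k 0) rg rn.
apply: eq_rec => s _; elim: (n s) => [|m IH]; first by rewrite big_geq.
by rewrite big_nat_recr//= -IH.
Qed.

(* A boolean function is recursive when its coercion to {0, 1} is. *)
Lemma rec_eq0 k a : rec k a -> rec k (fun s => a s == 0).
Proof.
move=> ra; apply: eq_rec (rec_sub (rec_const k 1) ra) => s _.
by case: (a s) => [|[]].
Qed.

Lemma rec_leq k a b : rec k a -> rec k b -> rec k (fun s => a s <= b s).
Proof. by move=> ra rb; apply/rec_eq0/rec_sub. Qed.

Lemma rec_not k (p : seq nat -> bool) : rec k p -> rec k (fun s => ~~ p s).
Proof. by move=> /rec_eq0; apply: eq_rec => s _; case: (p s). Qed.

Lemma rec_and k (p q : seq nat -> bool) :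
  rec k p -> rec k q -> rec k (fun s => p s && q s).
Proof.
by move=> rp rq; apply: eq_rec (rec_mul rp rq) => s _; rewrite mulnb.
Qed.

Lemma rec_or k (p q : seq nat -> bool) :
  rec k p -> rec k q -> rec k (fun s => p s || q s).
Proof.
move=> rp rq; apply: eq_rec (rec_not (rec_and (rec_not rp) (rec_not rq))) => s _.
by rewrite negb_and !negbK.
Qed.

Lemma rec_imp k (p q : seq nat -> bool) :
  rec k p -> rec k q -> rec k (fun s => p s ==> q s).
Proof.
move=> rp rq; apply: eq_rec (rec_or (rec_not rp) rq) => s _.
by rewrite implybE.
Qed.

Lemma rec_eq k a b : rec k a -> rec k b -> rec k (fun s => a s == b s).
Proof.
move=> ra rb; apply: eq_rec (rec_and (rec_leq ra rb) (rec_leq rb ra)) => s _.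
by rewrite -eqn_leq.
Qed.

Lemma rec_if k (p : seq nat -> bool) a b :
  rec k p -> rec k a -> rec k b -> rec k (fun s => if p s then a s else b s).
Proof.
move=> rp ra rb.
apply: eq_rec (rec_add (rec_mul rp ra) (rec_mul (rec_not rp) rb)) => s _.
by case: (p s); rewrite ?mul1n ?mul0n ?addn0.
Qed.

Lemma rec_all k n (p : nat -> seq nat -> bool) :
  rec k n -> rec k.+1 (fun w => p w#0 (behead w)) ->
  rec k (fun s => all (fun i => p i s) (iota 0 (n s))).
Proof.
move=> rn rp.
have rg := rec_mul (rec_nth (isT : 1 < k.+2)) (rec_skip rp).
have := rec_prim (g := fun i x s => x * p i s) (rec_const k 1) rg rn.
apply: eq_rec => s _; elim: (n s) => [//|m IH].
by rewrite -[m.+1]addn1 iotaD all_cat/= andbT -mulnb -IH addn1.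
Qed.

(** The accumulator equals the index [i] exactly as long as no hit has occurred; it then grows iff
    [i] fails, and is frozen from the first hit on. *)
Lemma rec_find k n (p : nat -> seq nat -> bool) :
  rec k n -> rec k.+1 (fun w => p w#0 (behead w)) ->
  rec k (fun s => find (fun i => p i s) (iota 0 (n s))).
Proof.
move=> rn rp.
have rg := rec_add (rec_nth (isT : 1 < k.+2)) (rec_and
  (rec_eq (rec_nth (isT : 1 < k.+2)) (rec_nth (isT : 0 < k.+2)))
  (rec_not (rec_skip rp))).
have := rec_prim (g := fun i x s => x + ((x == i) && ~~ p i s)) (rec_const k 0) rg rn.
apply: eq_rec => s _; elim: (n s) => [//|m IH].
rewrite -[m.+1 in RHS]addn1 iotaD find_cat/= -/(prim _ _ _) IH has_find size_iota.
have := find_size (p^~ s) (iota 0 m); rewrite size_iota leq_eqVlt.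
case/predU1P=> [->|lt]; last by rewrite lt ltn_eqF ?addn0.
by rewrite eqxx ltnn add0n; case: (p m s).
Qed.

Lemma rec_exp k a b : rec k a -> rec k b -> rec k (fun s => a s ^ b s).
Proof.
move=> ra rb.
have rg := rec_mul (rec_shift (rec_shift ra)) (rec_nth (isT : 1 < k.+2)).
have := rec_prim (g := fun i x s => a s * x) (rec_const k 1) rg rb.
by apply: eq_rec => s _; elim: (b s) => [|n IH]; rewrite ?expn0// expnS -IH.
Qed.

Lemma rec_odd k a : rec k a -> rec k (fun s => odd (a s)).
Proof.
move=> ra; have rg := rec_eq0 (rec_nth (isT : 1 < k.+2)).
have := rec_prim (g := fun i x s => x == 0) (rec_const k 0) rg ra.
apply: eq_rec => s _; elim: (a s) => [//|n IH].
by rewrite /= -/(prim _ _ _) IH; case: odd.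
Qed.

Lemma rec_half k a : rec k a -> rec k (fun s => (a s)./2).
Proof.
move=> ra; have rg := rec_add (rec_odd (rec_nth (isT : 0 < k.+2)))
  (rec_nth (isT : 1 < k.+2)).
have := rec_prim (g := fun i x s => odd i + x) (rec_const k 0) rg ra.
apply: eq_rec => s _; elim: (a s) => [//|n IH].
by rewrite -uphalfE uphalf_half -IH.
Qed.

Lemma rec_all_seq (I : Type) (r : seq I) k (p : I -> seq nat -> bool) :
  (forall i, rec k (p i)) -> rec k (fun s => all (p^~ s) r).
Proof.
move=> rp; elim: r => [|i r IH]; first exact: rec_const.
exact: rec_and.
Qed.

(* Dispatches on the head symbol: blind unification would unfold the functions
   being compared. *)
Ltac rec_step := lazymatch goal with
  | |- rec _ (fun=> ?n) => apply: rec_const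
  | |- rec _ (fun s => s#_) => apply: rec_nth
  | |- rec _ (fun s => (behead s)#_) => apply: rec_behead
  | |- rec _ (fun s => (behead (behead s))#_) => apply: rec_behead2
  | |- rec _ (fun s => S (@?a s)) => apply: rec_succ
  | |- rec _ (fun s => Nat.pred (@?a s)) => apply: rec_pred
  | |- rec _ (fun s => muln (@?a s) (@?b s)) => apply: rec_mul
  | |- rec _ (fun s => expn (@?a s) (@?b s)) => apply: rec_exp
  | |- rec _ (fun s => bigop _ _ _) => apply: rec_sum
  | |- rec _ (fun s => find (fun i => @?p i s) (iota 0 (@?n s))) =>
      apply: (rec_find (p := p))
  | |- rec _ (fun s => nat_of_bool (leq (@?a s) (@?b s))) => apply: rec_leq
  | |- rec _ (fun s => nat_of_bool (@?a s == @?b s)) => apply: rec_eq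
  | |- rec _ (fun s => nat_of_bool (~~ @?p s)) => apply: rec_not
  | |- rec _ (fun s => nat_of_bool (@?p s && @?q s)) => apply: rec_and
  | |- rec _ (fun s => nat_of_bool (@?p s ==> @?q s)) => apply: rec_imp
  | |- rec _ (fun s => nat_of_bool (all (fun i => @?p i s) (iota 0 (@?n s)))) =>
      apply: (rec_all (p := p))
  end.

Lemma recursive_rec k (f : k.-tuple nat -> nat) (g : seq nat -> nat) :
  (forall v : k.-tuple nat, f v = g v) -> recursive f <-> rec k g.
Proof.
move=> fg; split=> -[c cP]; exists c => v y; rewrite cP.
  by rewrite -fg; split=> [[]|->].
by rewrite -fg; split=> [->|[]].
Qed.

Lemma recursive1_rec f : recursive1 f <-> rec 1 (fun s => f s#0).
Proof. by apply: recursive_rec => v; rewrite (tnth_nth 0). Qed.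

(** * Evaluation with bounded minimization *)

(* [clock c t s] is [y.+1] if c halts on s with value y when every minimization
   is restricted to arguments below t, and 0 otherwise. *)
Fixpoint clock k (c : recalg k) (t : nat) (s : seq nat) : nat :=
  match c with
  | Rzero _ => 1
  | Rsucc => (s#0).+2
  | Rproj _ i => (s#i).+1
  | Rcomp k _ f g => if all (fun i => clock (g i) t s != 0) (enum 'I_k)
      then clock f t [seq (clock (g i) t s).-1 | i <- enum 'I_k] else 0
  | Rprec _ f g => prim (clock f t (behead s))
      (fun i x => if x == 0 then 0 else clock g t (i :: x.-1 :: behead s)) s#0
  | Rmin _ f => let y := find (fun i => clock f t (i :: s) <= 1) (iota 0 t) in
      if (y < t) && (clock f t (y :: s) == 1) then y.+1 else 0
  end.

Lemma rec_clock k (c : recalg k) :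
  rec k.+1 (fun w => clock c w#0 (behead w)).
Proof.
elim: {k}c => /= [k| |k i|k n f rf g rg|k f rf g rg|k f rf].
- exact: rec_const.
- by do 2!apply: rec_succ; apply: rec_behead.
- by apply/rec_succ/rec_behead; rewrite ltnS.
- apply: rec_if (rec_const _ 0).
    apply: (rec_all_seq _ (p := fun i w => clock (g i) w#0 (behead w) != 0)).
    by move=> i; apply/rec_not/rec_eq0.
  apply: (rec_comp (a := fun w => w#0 ::
    [seq (clock (g i) w#0 (behead w)).-1 | i <- enum 'I_k])) rf => [s _|[|i] ik].
  - by rewrite /= size_map size_enum_ord.
  - exact: rec_nth.
  apply: eq_rec (rec_pred (rg (Ordinal (ik : i < k)))) => s _ /=.
  rewrite (nth_map (Ordinal (ik : i < k))) ?size_enum_ord//.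
  by have /= -> := nth_ord_enum (Ordinal (ik : i < k)) (Ordinal (ik : i < k)).
- apply: (rec_prim (g := fun i x w => if x == 0 then 0 else
    clock g w#0 (i :: x.-1 :: behead (behead w)))).
  + apply: (rec_comp (a := fun w => w#0 :: behead (behead w))) rf => [s sk|[|i] ik].
    * by rewrite /= !size_behead sk.
    * exact: rec_nth.
    exact: rec_behead2.
  + apply: rec_if (rec_const _ _) _; first by apply/rec_eq0/rec_nth.
    (* The list holds index, accumulator, clock bound, recursion argument and parameters; [clock g]
       wants clock bound, index, previous value and parameters. *)
    apply: (rec_comp (a := fun w => (behead (behead w))#0 :: w#0 :: w#1.-1
        :: behead (behead (behead (behead w))))) rg => [s sk|[|[|[|i]]] ik /=].
    * by rewrite /= !size_behead sk.
    * exact: rec_behead2.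
    * exact: rec_nth.
    * exact/rec_pred/rec_nth.
    by apply: eq_rec (@rec_nth _ i.+4 _) => // s _; rewrite !nth_behead.
  + exact: rec_behead.
- pose y w := find (fun i => clock f w#0 (i :: behead w) <= 1) (iota 0 w#0).
  have ry : rec k.+1 y.
    apply: (rec_find (p := fun i w => clock f w#0 (i :: behead w) <= 1)).
      exact: rec_nth.
    apply: rec_leq (rec_const _ _).
    apply: (rec_comp (a := fun w => (behead w)#0 :: w#0 :: behead (behead w)))
      rf => [s sk|[|[|i]] ik /=]; rewrite /= ?size_behead ?sk//.
    - exact: rec_behead.
    - exact: rec_nth.
    exact: rec_behead2.
  apply: rec_if; [apply: rec_and; [apply: rec_leq|apply: rec_eq] | |];
    try exact: rec_const.
  - exact: rec_succ.
  - exact: rec_nth.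
  - apply: (rec_comp (a := fun w => w#0 :: y w :: behead w)) rf
      => [s sk|[|[|i]] ik //].
    + by rewrite /= size_behead sk.
    + exact: rec_nth.
    exact: rec_behead.
  - exact: rec_succ.
Qed.

Lemma find_iotaP (p : pred nat) n y : y < n ->
  find p (iota 0 n) = y <-> p y /\ forall i, i < y -> ~~ p i.
Proof.
move=> yn; split=> [fy|[py npi]].
  have := nth_find 0 (_ : has p (iota 0 n)); rewrite has_find size_iota fy nth_iota//.
  move=> /(_ yn) ?; split=> // i iy.
  have := @before_find _ 0 p (iota 0 n) i.
  by rewrite fy nth_iota ?(ltn_trans iy yn)// => /(_ iy) ->.
have [|yf|//] := ltngtP (find p (iota 0 n)) y.
  move=> fy; have /npi/negP[] := fy.
  have := nth_find 0 (_ : has p (iota 0 n)); rewrite has_find size_iota.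
  by rewrite nth_iota (ltn_trans fy yn)// => /(_ isT).
by have := before_find 0 yf; rewrite nth_iota// py.
Qed.

(** The search stops at the first [i] whose clock is 0 (no value within the bound) or 1 (value 0),
    and only the latter is a success. The default [t] of [find] is excluded by [y < t]. *)
Lemma clock_min k (f : recalg k.+1) t s y : clock (Rmin f) t s = y.+1 <->
  [/\ y < t, clock f t (y :: s) = 1 & forall i, i < y -> 1 < clock f t (i :: s)].
Proof.
rewrite /=; set z := find _ _; split=> [|[yt fy fi]].
  case: ifP => // /andP[zt /eqP fz] [<-]; split=> // i.
  have /(find_iotaP (fun i => clock f t (i :: s) <= 1) zt)[_ zi] := erefl z.
  by move=> /zi; rewrite ltnNge.
have -> : z = y; last by rewrite yt fy.
by apply/find_iotaP => //; rewrite fy; split=> // i /fi; rewrite ltnNge.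
Qed.

(** A successful bounded minimization has already seen positive values at all arguments below its
    result; these persist under a larger bound, so the result does too. *)
Lemma clock_mono k (c : recalg k) t t' s y :
  t <= t' -> clock c t s = y.+1 -> clock c t' s = y.+1.
Proof.
move=> tt'; elim: {k}c s y => [k| |k i|k n f IHf g IHg|k f IHf g IHg|k f IHf] s y //.
- rewrite /=; case: ifP => // /allP gt.
  have gt' i : clock (g i) t' s = clock (g i) t s.
    have gi : clock (g i) t s != 0 by rewrite gt ?mem_enum.
    by rewrite (IHg _ _ (clock (g i) t s).-1) prednK// lt0n.
  move=> /IHf <-; case: ifP => [_|/allP[] i]; last by rewrite gt'; apply: gt.
  by congr clock; apply: eq_map => i; rewrite gt'.
- rewrite /=; elim: (s#0) y => [|n IH] y /=; first exact: IHf.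
  rewrite -!/(prim _ _ _); move: IH; case: (prim _ _ n) => // x IH /=.
  by rewrite (IH x)//; exact: IHg.
- case/clock_min=> yt fy fi; apply/clock_min; split=> [||i /fi].
  - exact: leq_trans tt'.
  - exact: IHf.
  by case ft: (clock f t _) => [//|z] z1; rewrite (IHf _ z).
Qed.

(** A halting computation performs finitely many minimizations, so by [clock_mono] the maximum of
    the bounds of its subcomputations serves them all. *)
Lemma sem_clock k (c : recalg k) (v : k.-tuple nat) y :
  sem c v y <-> exists t, clock c t v = y.+1.
Proof.
elim: {k}c v y => [k| |k i|k n f IHf g IHg|k f IHf g IHg|k f IHf] v y.
- by split=> [/= ->|[t [<-]]]; first by exists 0.
- by rewrite /= /thead (tnth_nth 0); split=> [->|[t [<-]]]; first by exists 0.
- by rewrite /= (tnth_nth 0); split=> [->|[t [<-]]]; first by exists 0.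
- split=> [[w gw /IHf[t ft]]|[t /=]].
    have /choice[u uP] i : exists u, clock (g i) u v = (tnth w i).+1 by apply/IHg/gw.
    pose T := maxn t (\max_i u i); exists T => /=.
    have gT i : clock (g i) T v = (tnth w i).+1.
      by apply: clock_mono (uP i); rewrite /T leq_max leq_bigmax orbT.
    rewrite (eq_all (a2 := xpredT)) ?all_predT => [|i]; last by rewrite gT.
    apply: clock_mono (leq_maxl _ _) _; rewrite -ft; congr clock.
    by rewrite -[RHS]map_tnth_enum; apply: eq_map => i; rewrite gT.
  case: ifP => // /allP gt ft.
  exists [tuple (clock (g i) t v).-1 | i < k].
    move=> i; apply/IHg; exists t.
    by rewrite tnth_mktuple prednK// lt0n gt ?mem_enum.
  by apply/IHf; exists t; rewrite -ft; congr clock; rewrite /= -map_comp.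
- have tv : thead v = v#0 by rewrite /thead (tnth_nth 0).
  split=> [[h [/IHf[t0 h0] hS ->]]|[t /= pt]].
    rewrite tv /=; suff: forall n, n <= v#0 -> exists t,
      prim (clock f t (behead v)) (fun i x => if x == 0 then 0 else
        clock g t (i :: x.-1 :: behead v)) n = (h n).+1.
      by apply.
    elim=> [|n IH] nv; first by exists t0.
    have [t1 ht1] := IH (ltnW nv).
    have [|t2 ht2] := (IHg _ _).1 (hS n _); first by rewrite tv.
    exists (maxn t1 t2); rewrite primS.
    have /= -> := @clock_mono _ (Rprec f g) t1 (maxn t1 t2) (n :: behead v) (h n)
      (leq_maxl _ _) ht1.
    exact: clock_mono (leq_maxr _ _) ht2.
  set P := prim _ _ in pt.
  (* Since 0 is absorbing for the iteration, a nonzero final value forces all earlier ones to be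
     nonzero, by descent from [v#0]. *)
  have nz n : P (v#0 - n) != 0.
    elim: n => [|n IH]; first by rewrite subn0 pt.
    have [vn|nv] := leqP v#0 n.
      by move: vn IH; rewrite subnS -subn_eq0 => /eqP->.
    by move: IH; rewrite -(subnSK nv) /= -/(P _); case: (P _).
  have {}nz n : n <= v#0 -> P n = (P n).-1.+1.
    by move=> /subKn <-; rewrite prednK// lt0n.
  exists (fun n => (P n).-1); split.
  - by apply/IHf; exists t; rewrite -nz.
  - rewrite tv => n nv; apply/IHg; exists t; rewrite -nz// /P /= -!/(prim _ _ _) -/P.
    by rewrite nz ?(ltnW nv).
  by rewrite tv pt.
- split=> [[/IHf[t ft] fi]|[t /clock_min[_ fy fi]]].
    have /choice[u uP] (i : 'I_y) : exists u, 1 < clock f u (val i :: v).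
      by have [z /IHf[u uz]] := fi i (ltn_ord i); exists u; move: uz => /= ->.
    (* The term [y.+1] brings [y] into the range of the search. *)
    pose T := maxn (maxn t y.+1) (\max_i u i); exists T; apply/clock_min; split.
    + by rewrite /T !leq_max leqnn orbT.
    + by apply: clock_mono ft; rewrite /T !leq_max leqnn.
    move=> i iy; have := uP (Ordinal iy); case ui: (clock _ _ _) => [//|z].
    move=> z1; rewrite (clock_mono _ ui)// /T leq_max.
    by rewrite (leq_bigmax (Ordinal iy)) orbT.
  split=> [|i /fi f1]; first by apply/IHf; exists t.
  (* One predecessor undoes the shift of [clock], the other the successor in the positive value
     [z.+1]. *)
  exists (clock f t (i :: v)).-2; apply/IHf; exists t => /=.
  by case: (clock _ _ _) f1 => [|[]].
Qed.

(** * Canonical indices and defects *)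

(** The binary digit of weight [2 ^ x] in [y], hence membership of [x] in the set with canonical
    index [y]. *)
Definition nbit x y := odd (iter x half y).

Lemma nbitS x y : nbit x.+1 y = nbit x y./2.
Proof. by rewrite /nbit iterSr. Qed.

(** Since [x < 2 ^ x <= y], sums over a coded set may be run up to its code. *)
Lemma nbit_lt x y : nbit x y -> x < y.
Proof.
elim: x y => [|x IH] y; first by rewrite /nbit /=; case: y.
by rewrite nbitS => /IH; lia.
Qed.

(** Membership of 0 is the parity of the sum, and halving the sum shifts the remaining elements down
    by one. *)
Lemma nbit_sum (s : seq nat) x : uniq s -> nbit x (\sum_(z <- s) 2 ^ z) = (x \in s).
Proof.
have sumE (r : seq nat) : uniq r -> \sum_(z <- r) 2 ^ z =
    (0 \in r) + (\sum_(z <- [seq z.-1 | z <- r & z != 0]) 2 ^ z).*2.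
  elim: r => [|z r IH] /=; first by rewrite big_nil.
  move=> /andP[zr /IH{}IH]; rewrite big_cons IH in_cons eq_sym.
  case: z zr => [|z] zr /=; first by rewrite (negPf zr).
  by rewrite big_cons expnS -addnn; lia.
elim: x s => [|x IH] s us; rewrite (sumE _ us).
  by rewrite /nbit /= oddD odd_double addbF oddb.
rewrite nbitS half_bit_double IH.
  apply/mapP/idP => [[z]|xs]; last by exists x.+1; rewrite ?mem_filter.
  by rewrite mem_filter => /andP[z0 zs] ->; rewrite prednK ?lt0n.
rewrite map_inj_in_uniq ?filter_uniq// => z z'; rewrite !mem_filter.
by case: z z' => [|z] [|z'] //= _ _ ->.
Qed.

Lemma sum_nbit n y : y <= n -> \sum_(0 <= x < n) nbit x y * 2 ^ x = y.
Proof.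
elim: n y => [|n IH] y yn; first by rewrite big_geq//; lia.
rewrite big_nat_recl// expn0 muln1.
under eq_bigr do rewrite nbitS expnS mulnCA.
by rewrite -big_distrr/= IH ?/nbit/=; lia.
Qed.

Definition code_set y : {fset nat} := [fset x in iota 0 y | nbit x y]%fset.

Lemma in_code_set x y : (x \in code_set y) = nbit x y.
Proof.
by rewrite !inE mem_iota; apply/andP/idP => [[]//|xy]; rewrite nbit_lt.
Qed.

Lemma big_code_set y (f : nat -> nat) :
  \sum_(x <- code_set y) f x = \sum_(0 <= x < y) nbit x y * f x.
Proof.
rewrite (perm_big [seq x <- iota 0 y | nbit x y]).
  rewrite big_filter big_mkcond /index_iota subn0.
  by apply: eq_bigr => x _; case: nbit; rewrite ?mul1n ?mul0n.
apply: uniq_perm; rewrite ?filter_uniq ?iota_uniq// ?fset_uniq// => x.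
rewrite in_code_set mem_filter mem_iota andbC.
by apply/idP/andP => [xy|[]//]; rewrite nbit_lt.
Qed.

Lemma code_setK : cancel code_set canonical_index.
Proof. by move=> y; rewrite /canonical_index big_code_set sum_nbit. Qed.

Lemma canonical_indexK : cancel canonical_index code_set.
Proof.
by move=> A; apply/fsetP => x; rewrite in_code_set nbit_sum ?fset_uniq.
Qed.

Lemma card_fset_sum (A : {fset nat}) n (p : pred nat) :
  (forall x, (x \in A) = (x < n) && p x) -> #|` A| = \sum_(0 <= x < n) p x.
Proof.
move=> Ap; rewrite /index_iota subn0 -[RHS]big_mkcond.
rewrite sum1_count -size_filter; apply: perm_size.
apply: uniq_perm; rewrite ?filter_uniq ?iota_uniq ?fset_uniq// => x.
by rewrite mem_filter mem_iota Ap andbC.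
Qed.

(** * Defects and almost invariance in an arbitrary group *)

Section Folner.
Variables (G : groupType).
Implicit Types (F : {fset G}) (g h x : G).
Local Open Scope fset_scope.

Definition translate F g := [fset (g * x)%g | x in F].

Definition defect F g := #|` [fset x in F | (g * x)%g \notin F]|.

(** Translation by [g] maps the points of [F] that stay in [F] bijectively onto the intersection of
    [F] and [g F]; both sides are complements in [F]. *)
Lemma card_translateD F g : #|` F `\` translate F g| = defect F g.
Proof.
set S := [fset x in F | (g * x)%g \in F].
have -> : defect F g = #|` F `\` S|.
  by congr #|` _|; apply/fsetP => x; rewrite !inE; case: (x \in F); rewrite ?andbF ?andbT.
have SF : F `&` S = S.
  by apply/fsetP => x; rewrite !inE; case: (x \in F).
rewrite !cardfsD SF; congr (_ - _)%N.
have <- : #|` [fset (g * x)%g | x in S]| = #|` S|.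
  by rewrite card_imfset//=; exact: mulgI.
congr #|` _|; apply/fsetP => x.
rewrite inE; apply/andP/imfsetP => [[xF /imfsetP[y yF xE]]|[y]].
  by exists y => //; rewrite !inE/= yF -xE.
rewrite !inE/= => /andP[yF gyF] ->; split=> //.
exact: in_imfset.
Qed.

(** Convergence of the ratio to 0 without division, tested against the bounds [1 / (k + 1)]. *)
Definition almost_invariant (F : nat -> {fset G}) g :=
  forall k, exists N, forall j, N <= j -> (k.+1 * defect (F j) g <= #|` F j|)%N.

Local Open Scope classical_set_scope.
Local Open Scope ring_scope.
Import Order.TTheory GRing.Theory Num.Theory.
Import numFieldNormedType.Exports.

Lemma folnerP (R : realType) (F : nat -> {fset G}) :
  folner R F <-> (forall j, F j != fset0) /\ forall g, almost_invariant F g.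
Proof.
rewrite /folner; split=> -[F0 Fg]; split=> // g.
  move=> k; have /cvgrPdist_le /(_ (k.+1%:R^-1)) := Fg g.
  rewrite invr_gt0 ltr0n => /(_ isT)[N _ NF]; exists N => j /NF /=.
  rewrite sub0r normrN card_translateD ger0_norm; last by rewrite divr_ge0.
  by rewrite ler_pdivrMr ?ltr0n ?cardfs_gt0// mulrC ler_pdivlMr// -natrM ler_nat mulnC.
apply/cvgrPdist_le => e e0.
(* The factor [truncn e^-1 + 1] exceeds [e^-1], so the ratio is at most [e]. *)
have [N NF] := Fg g (Num.truncn e^-1); exists N => // j /NF /=.
rewrite sub0r normrN card_translateD ger0_norm; last by rewrite divr_ge0.
rewrite ler_pdivrMr ?ltr0n ?cardfs_gt0// => NFj.
rewrite -ler_pdivrMl//.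
apply: (@le_trans _ _ ((Num.truncn e^-1).+1%:R * (defect (F j) g)%:R)).
  by rewrite ler_wpM2r// ltW// real_truncnS_gt// num_real.
by rewrite -natrM ler_nat.
Qed.

(** If [g h x] is outside [F], then either [h x] is outside, or [h x] is a point of [F] counted in
    the defect of [g]; [x |-> h x] is injective. *)
Lemma almost_invariantM (F : nat -> {fset G}) g h :
  almost_invariant F g -> almost_invariant F h -> almost_invariant F (g * h)%g.
Proof.
move=> Fg Fh k; have [[N NF] [M MF]] := (Fg k.*2.+1, Fh k.*2.+1).
exists (maxn N M) => j; rewrite geq_max => /andP[/NF Nj /MF Mj].
suff: (defect (F j) (g * h)%g <= defect (F j) g + defect (F j) h)%N by nia.
pose A := [fset x in F j | (g * (h * x))%g \notin F j & (h * x)%g \in F j]%fset.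
have : ([fset x in F j | (g * h * x)%g \notin F j] `<=`
    A `|` [fset x in F j | (h * x)%g \notin F j])%fset.
  apply/fsubsetP => x; rewrite !inE -mulgA.
  by case: (_ \in _); case: (_ \in _); case: (_ \in _).
move=> /fsubset_leq_card /leq_trans; apply.
rewrite cardfsU; apply: leq_trans (leq_subr _ _) _; rewrite leq_add2r.
have <- : #|` [fset (h * x)%g | x in A]%fset| = #|` A|.
  by rewrite card_imfset//=; exact: mulgI.
apply: fsubset_leq_card; apply/fsubsetP => _ /imfsetP[x /= xA ->].
by move: xA; rewrite !inE => /and3P[_ -> ->].
Qed.

(** The defects of [g] and its inverse agree: [F] minus [g F] consists of the [x] in [F] with
    [g^-1 x] outside [F]. *)
Lemma almost_invariantV (F : nat -> {fset G}) g :
  almost_invariant F g -> almost_invariant F g^-1%g.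
Proof.
move=> Fg k; have [N NF] := Fg k; exists N => j /NF.
suff -> : defect (F j) g^-1%g = defect (F j) g by [].
rewrite -(card_translateD _ g); congr #|` _|; apply/fsetP => x.
rewrite !inE /= andbC; congr andb; congr negb; apply/idP/imfsetP.
  by move=> ?; exists (g^-1 * x)%g; rewrite // mulVKg.
by case=> y yF ->; rewrite mulKg.
Qed.

Lemma almost_invariant1 (F : nat -> {fset G}) : almost_invariant F 1%g.
Proof.
move=> k; exists 0%N => j _; rewrite (_ : defect _ _ = 0%N) ?muln0//.
by apply/eqP; rewrite cardfs_eq0; apply/eqP/fsetP => x; rewrite !inE mul1g andbN.
Qed.

End Folner.

(** * The upper bound *)

Lemma rec_nbit k a b : rec k a -> rec k b -> rec k (fun s => nbit (a s) (b s)).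
Proof.
move=> ra rb; have rg := rec_half (rec_nth (isT : 1 < k.+2)).
have := rec_odd (rec_prim (g := fun _ x _ => x./2) rb rg ra).
by apply: eq_rec => s _; congr (odd _ : nat); elim: (a s) => //= n <-.
Qed.

Lemma mem_fset_sep (K : choiceType) (A : {fset K}) (p : pred K) x :
  (x \in [fset y in A | p y]%fset) = (x \in A) && p x.
Proof. by rewrite !inE. Qed.

(** * Foelner conditions read off canonical indices *)

Section Coding.
Variables (G : groupType) (nu : nat -> G).
Hypotheses (nu_inj : injective nu) (nu_surj : forall g, exists n, nu n = g).
Variable mul : nat -> nat -> nat.
Hypothesis nuM : forall i j, nu (mul i j) = (nu i * nu j)%g.

Definition coded_card y := \sum_(0 <= x < y) nbit x y.

Definition coded_defect i y := \sum_(0 <= x < y) (nbit x y && ~~ nbit (mul i x) y).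

Lemma card_coded y : #|` [fset nu x | x in code_set y]%fset| = coded_card y.
Proof.
rewrite card_imfset//=; apply: card_fset_sum => x.
by rewrite in_code_set; apply/idP/andP => [xy|[]//]; rewrite nbit_lt.
Qed.

Lemma defect_coded i y :
  defect [fset nu x | x in code_set y]%fset (nu i) = coded_defect i y.
Proof.
rewrite /defect.
have nuE x : (nu x \in [fset nu x | x in code_set y]%fset) = nbit x y.
  by rewrite mem_imfset//= in_code_set.
rewrite (_ : [fset _ in _ | _]%fset =
    [fset nu x | x in [fset x in code_set y | ~~ nbit (mul i x) y]]%fset).
  rewrite card_imfset//=; apply: card_fset_sum => x.
  rewrite mem_fset_sep in_code_set; case xy: (nbit x y); rewrite ?andbF//=.
  by rewrite (nbit_lt xy).
apply/fsetP => z; have [x <-] := nu_surj z.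
by rewrite mem_fset_sep -nuM !nuE mem_imfset//= mem_fset_sep in_code_set.
Qed.

(** As [code_set] inverts [canonical_index], the sets are determined by [n]; the real limit becomes
    inequalities between natural numbers. *)
Lemma effective_folnerP (R : realType) (n : nat -> nat) :
  effective_folner R nu n <-> [/\ recursive1 n, forall j, 0 < coded_card (n j) &
    forall i k, exists N, forall j, N <= j ->
      k.+1 * coded_defect i (n j) <= coded_card (n j)].
Proof.
rewrite /effective_folner; split=> [[rn [F nF /folnerP[F0 Fg]]]|[rn n0 nN]].
  have FE j : F j = code_set (n j) by rewrite nF canonical_indexK.
  split=> // [j|i k]; first by rewrite -card_coded cardfs_gt0 -FE.
  have [N NF] := Fg (nu i) k; exists N => j.
  by rewrite -card_coded -defect_coded -FE; exact: NF.
split=> //; exists (code_set \o n) => [j|]; first by rewrite /= code_setK.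
apply/folnerP; split=> [j|g k]; first by rewrite -cardfs_gt0 card_coded.
have [i <-] := nu_surj g; have [N NF] := nN i k; exists N => j.
by rewrite /= card_coded defect_coded; exact: NF.
Qed.

Lemma rec_coded_card k a : rec k a -> rec k (fun s => coded_card (a s)).
Proof.
move=> ra; apply: (rec_app1 (f := coded_card)) ra.
apply: (rec_sum (f := fun x s => nbit x s#0)); first exact: rec_nth.
by apply: rec_nbit; [exact: rec_nth|exact: rec_behead].
Qed.

Lemma rec_coded_defect k a b : rec 2 (fun s => mul s#0 s#1) ->
  rec k a -> rec k b -> rec k (fun s => coded_defect (a s) (b s)).
Proof.
move=> rM; apply: (rec_app2 (f := coded_defect)).
apply: (rec_sum (f := fun x s => nbit x s#1 && ~~ nbit (mul s#0 x) s#1)).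
  exact: rec_nth.
apply: rec_and; [apply: rec_nbit|apply/rec_not/rec_nbit];
  solve [exact: rec_nth | exact: rec_behead |
    by apply: (rec_app2 rM); [exact: rec_behead|exact: rec_nth]].
Qed.
End Coding.

(** The code of a product is found by searching the decidable graph of multiplication: surjectivity
    of [nu] makes the search end, injectivity makes the answer unique. *)
Lemma computable_mul (G : groupType) (nu : nat -> G) : computable_group nu ->
  exists2 mul, forall i j, nu (mul i j) = (nu i * nu j)%g &
    rec 2 (fun s => mul s#0 s#1).
Proof.
move=> [/choice[inv invK] nu_inj [chi rchi chiP]].
pose mul i j := inv (nu i * nu j)%g; exists mul => [i j|]; first exact: invK.
pose p s := 1 - chi [tuple s#1; s#2; s#0].
apply: (rec_least (p := p)) => [|s s2].
  rewrite /p; apply: (rec_sub (rec_const _ _)).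
  apply: (rec_app3 (f := fun a b c => chi [tuple a; b; c])); try exact: rec_nth.
  apply: (proj1 (recursive_rec _) rchi) => v; congr (chi _ : nat).
  by apply: val_inj; case: v => -[|? [|? [|? []]]].
have chiE k : chi [tuple s#0; s#1; k] <-> k = mul s#0 s#1.
  rewrite -chiP /= !(tnth_nth 0)/=; split=> [h|->]; last by rewrite invK.
  by apply: nu_inj; rewrite invK.
split=> [|k km]; rewrite /p/=; first by rewrite (chiE _).2.
case E: (chi _) => //; move/chiE: E km => ->; by rewrite ltnn.
Qed.

(** * The index set through three quantifiers over a decidable relation *)

Section Upper.
Variables (R : realType) (phi : nat -> nat -> option nat).
Hypothesis rphi : partial_recursive2 phi.

(** At stage [t], 0 means no value so far and [y.+1] means the value [y], so halting becomes a
    decidable relation increasing in [t]. *)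
Lemma stage_function : exists2 q : nat -> nat -> nat -> nat,
    rec 3 (fun s => q s#0 s#1 s#2) &
    (forall t t' m j y, t <= t' -> q t m j = y.+1 -> q t' m j = y.+1) /\
    forall m j y, phi m j = Some y <-> exists t, q t m j = y.+1.
Proof.
have [c cP] := rphi; exists (fun t m j => clock c t [:: m; j]).
  apply: eq_rec (rec_clock c) => s.
  by case: s => [|? [|? [|? []]]].
split=> [t t' m j y|m j y]; first exact: clock_mono.
have := sem_clock c [tuple m; j] y.
by rewrite cP !(tnth_nth 0).
Qed.

Lemma Pi03_indices (G : groupType) (nu : nat -> G) : computable_group nu ->
  Pi03 (effective_folner_indices R nu phi).
Proof.
move=> cG; have [mul nuM rM] := computable_mul cG; have [nuS nuI _] := cG.
have [q rq [qmono qP]] := stage_function.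
(* Before halting [q] is 0, whose predecessor 0 codes the empty set, so the first conjunct also
   forces halting by stage [b]. In the second, [c] both bounds [j] and is the stage of
   inspection. *)
pose P m a b c := all (fun j => 0 < coded_card (q b m j).-1) (iota 0 a.+1) &&
  all (fun j => all (fun i => (b <= j) && (q c m j != 0) ==>
    (a.+1 * coded_defect mul i (q c m j).-1 <= coded_card (q c m j).-1))
    (iota 0 a.+1)) (iota 0 c.+1).
exists [set v : 4.-tuple nat | P v#0 v#1 v#2 v#3]%classic.
  exists (fun v => P v#0 v#1 v#2 v#3) => //.
  apply/(recursive_rec (g := fun v => P v#0 v#1 v#2 v#3)) => //.
  rewrite /P.
  repeat first [rec_step | by [] | lazymatch goal with
    | |- rec _ (fun s => coded_card (@?a s)) => apply: rec_coded_card
    | |- rec _ (fun s => coded_defect _ (@?a s) (@?b s)) =>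
        apply: (rec_coded_defect rM)
    | |- rec _ (fun s => q (@?a s) (@?b s) (@?c s)) => apply: (rec_app3 rq) end].

  move=> m; split=> [[n nE]|mP].
  move=> /(effective_folnerP nuI nuS nuM)[rn n0 nN] a.
  have /choice[t tP] j : exists t, q t m j = (n j).+1 by apply/qP.
  have /choice[N NP] i : exists N, forall j, N <= j ->
    a.+1 * coded_defect mul i (n j) <= coded_card (n j) by apply: nN.
  (* This covers the halting stages of all [j <= a] and the thresholds of all elements [i <= a]. *)
  exists (maxn (\max_(j < a.+1) t j) (\max_(i < a.+1) N i)) => c.
  apply/andP; split; apply/allP => j; rewrite mem_iota add0n => /andP[_ ja].
    rewrite (qmono (t j) _ _ _ (n j)) ?n0//.
    by rewrite leq_max (leq_bigmax (Ordinal ja)).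
  apply/allP => i; rewrite mem_iota add0n => /andP[_ ia]; apply/implyP => /andP[].
  rewrite geq_max => /andP[_ Nj]; case qE: (q c m j) => [//|y] _ /=.
  have -> : y = n j.
    have [] : phi m j = Some y /\ phi m j = Some (n j) by split=> //; apply/qP; exists c.
    by move=> -> [].
  by apply: NP; apply: leq_trans Nj; rewrite (leq_bigmax (Ordinal ia)).
have {}mP a : exists b, forall c, P m a b c := mP a.
have /choice[n nE] j : exists y, phi m j = Some y.
  have [b /(_ 0)/andP[/allP/(_ j) + _]] := mP j.
  rewrite mem_iota add0n ltnSn => /(_ isT).
  case qE: (q b m j) => [|y]; first by rewrite /coded_card big_geq.
  by exists y; apply/qP; exists b.
have qn t j y : q t m j = y.+1 -> n j = y.
  move=> qy; have : phi m j = Some y by apply/qP; exists t.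
  by rewrite nE => -[].
exists n => //; apply/(effective_folnerP nuI nuS nuM); split.
(* [n] is recursive: its value is read off at the least halting stage [T j], found by
   minimization. *)
- have /choice[T TP] j : exists t,
      q t m j = (n j).+1 /\ forall i, i < t -> q i m j != 0 -> False.
    have [t tn] := (qP m j _).1 (nE j).
    have ex : exists t, q t m j != 0 by exists t; rewrite tn.
    case: (ex_minnP ex) => u u0 umin; exists u; split=> [|i iu /umin].
      by rewrite (qn u j (q u m j).-1) prednK// lt0n.
    by rewrite leqNgt iu.
  apply/recursive1_rec.
  have rT : rec 1 (fun s => T s#0).
    apply: (rec_least (p := fun s => q s#0 m s#1 == 0)) => [|s _].
      by repeat first [rec_step | by [] | apply: (rec_app3 rq)].
    have [/= -> Tmin] := TP s#0; split=> // i /Tmin.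
    by case: (q i m s#0) => //= ? /(_ isT).
  have r0 : rec 1 (fun s => s#0) by exact: rec_nth.
  apply: eq_rec (rec_pred (rec_app3 rq rT (rec_const 1 m) r0)) => s _.
  by rewrite (TP _).1.
- move=> j; have [b /(_ 0)/andP[/allP/(_ j) + _]] := mP j.
  rewrite mem_iota add0n ltnSn => /(_ isT).
  case qE: (q b m j) => [|y]; first by rewrite /coded_card big_geq.
  by rewrite (qn b j y).
(* Taking [a] as the maximum handles both the element [i] and the precision [k]. *)
move=> i k; have [b bP] := mP (maxn i k); exists b => j bj.
have [t tn] := (qP m j _).1 (nE j).
(* The choice of [c] admits [j] and is a stage by which [phi m j] has halted. *)
have /andP[_ /allP/(_ j)] := bP (maxn t j).
rewrite mem_iota add0n ltnS leq_maxr => /(_ isT)/allP/(_ i).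
rewrite mem_iota add0n ltnS leq_maxl => /(_ isT).
rewrite (qmono t _ _ _ _ _ tn) ?leq_maxl// bj /=; apply: leq_trans.
by rewrite leq_mul2r ltnS leq_maxr orbT.
Qed.
End Upper.

(** * Boxes in the direct sum *)

Section LeastCandidate.
Variable Q : nat -> nat -> bool.

(** When all candidates up to [j] are refuted, [find] returns [j.+1], the next one to be
    examined. *)
Definition candidate j :=
  find (fun b => all (fun c => Q b c) (iota 0 j.+1)) (iota 0 j.+1).

Lemma candidate_le j b : b <= j -> (forall c, c <= j -> Q b c) -> candidate j <= b.
Proof.
move=> bj Qb; rewrite leqNgt; apply/negP => /(before_find 0)/negP[].
rewrite nth_iota// add0n; apply/allP => c; rewrite mem_iota add0n ltnS.
exact: Qb.
Qed.

Lemma candidateP j c : candidate j <= j -> c <= j -> Q (candidate j) c.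
Proof.
move=> bj cj.
have /(nth_find 0) : has (fun b => all (fun c => Q b c) (iota 0 j.+1)) (iota 0 j.+1).
  by rewrite has_find size_iota ltnS.
by rewrite nth_iota// => /allP; apply; rewrite mem_iota.
Qed.

Lemma candidate_leS j : candidate j <= j.+1.
Proof. by rewrite -[leqRHS](size_iota 0); apply: find_size. Qed.

(** A candidate surviving the tests of a later stage survives the fewer tests of an earlier one, so
    the least survivor never decreases. *)
Lemma candidate_mono j j' : j <= j' -> candidate j <= candidate j'.
Proof.
elim: j' => [|j' IH]; first by case: j.
rewrite leq_eqVlt => /predU1P[->//|/IH/leq_trans]; apply.
rewrite leqNgt; apply/negP => lt.
have bj : candidate j'.+1 <= j' by rewrite -ltnS (leq_trans lt)// candidate_leS.
suff : candidate j' <= candidate j'.+1 by rewrite leqNgt lt.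
by apply: candidate_le => // c cj; apply: candidateP; apply: leqW.
Qed.

(** A correct [B] bounds the nondecreasing sequence, which is then eventually constant; conversely a
    limit is tested against every [c]. *)
Lemma candidate_stabilizes : (exists b, forall c, Q b c) <->
  exists J, forall j, J <= j -> candidate j = candidate j.+1.
Proof.
split=> [[B QB]|[J JP]].
  have bB j : candidate j <= B.
    have [Bj|jB] := leqP B j; first exact: candidate_le.
    exact: leq_trans (candidate_leS _) jB.
  have ex : exists M, `[< exists j, candidate j = M >].
    by exists (candidate 0); apply/asboolP; exists 0.
  have ub M : `[< exists j, candidate j = M >] -> M <= B by move=> /asboolP[j <-].
  case: (ex_maxnP ex ub) => M /asboolP[J JM] maxM; exists J.
  have eqM j : J <= j -> candidate j = M.
    move=> Jj; apply/eqP; rewrite eqn_leq -{2}JM candidate_mono// andbT.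
    by apply: maxM; apply/asboolP; exists j.
  by move=> j Jj; rewrite !eqM// leqW.
have eqJ j : J <= j -> candidate j = candidate J.
  elim: j => [|j IH]; first by rewrite leqn0 => /eqP->.
  by rewrite leq_eqVlt => /predU1P[->//|/[dup] /IH <- /JP ->].
(* [j] is past [J], past [c] so that [c] is tested, and past the limit itself so that this is a true
   candidate and not the default of [find]. *)
exists (candidate J) => c; pose j := maxn (maxn J c) (candidate J).
have Jj : J <= j by rewrite !leq_max leqnn.
rewrite -(eqJ j)//; apply: candidateP; last by rewrite !leq_max leqnn orbT.
by rewrite eqJ// leq_max leqnn orbT.
Qed.
End LeastCandidate.

(** * Coordinates, generators and defects of boxes *)

Section DirectSum.
Implicit Types (g h : dirsumZ) (n i l : nat).
Local Open Scope ring_scope.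
Import Order.TTheory GRing.Theory Num.Theory.

Definition zcoord g n : int := (g : {malg int[nat]})@_n.

Lemma zcoordM g h n : zcoord (g * h)%g n = zcoord g n + zcoord h n.
Proof. exact: mcoeffD. Qed.

Lemma zcoord1 n : zcoord 1%g n = 0.
Proof. exact: mcoeff0. Qed.

Lemma zcoordV g n : zcoord g^-1%g n = - zcoord g n.
Proof. exact: mcoeffN. Qed.

Lemma zcoord_gen i n : zcoord (dirsumZ_gen i) n = (n == i)%:Z.
Proof. by rewrite /zcoord mcoeffU eq_sym; case: (n == i). Qed.

Lemma zcoord_genX i l n : zcoord (dirsumZ_gen i ^+ l)%g n = ((n == i) * l)%N%:Z.
Proof.
elim: l => [|l IH]; first by rewrite expg0 zcoord1 muln0.
by rewrite expgS zcoordM IH zcoord_gen; case: (n == i); lia.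
Qed.

Lemma zcoord_inj g h : (forall n, zcoord g n = zcoord h n) -> g = h.
Proof. by move=> gh; apply/malgP. Qed.

(** Almost invariant elements form a subgroup, and every element is a product of integer powers of
    generators. *)
Lemma almost_invariant_gens (F : nat -> {fset dirsumZ}) :
  (forall n, almost_invariant F (dirsumZ_gen n)) -> forall g, almost_invariant F g.
Proof.
move=> Fgen.
have FX n k : almost_invariant F (<< k%:Z *g n >> : {malg int[nat]}).
  elim: k => [|k IH]; first by rewrite monalgU0; exact: almost_invariant1.
  rewrite intS monalgUD; exact: almost_invariantM (Fgen n) IH.
have FZ n (z : int) : almost_invariant F (<< z *g n >> : {malg int[nat]}).
  case: z => k; first exact: FX.
  by rewrite NegzE monalgUN; apply: almost_invariantV.
move=> g; rewrite [g]monalgE; elim: (enum_fset _) => [|n s IH].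
  by rewrite big_nil; exact: almost_invariant1.
by rewrite big_cons; apply: almost_invariantM.
Qed.

Definition in_box (L : nat -> nat) m g := forall n,
  if (n < m)%N then 0 <= zcoord g n < (L n)%:Z else zcoord g n == 0.

Lemma in_box1 L m : (forall n, (0 < L n)%N) -> in_box L m 1%g.
Proof. by move=> L0 n; rewrite zcoord1; case: ifP; rewrite // lexx ltz_nat L0. Qed.

Section BoxDefect.
Variables (L : nat -> nat) (m : nat) (F : {fset dirsumZ}).
Hypothesis FP : forall g, g \in F <-> in_box L m g.

(* The translates of the top face by the [L i] first powers of the inverse of
   the generator partition the box. *)
Lemma box_defect_le i : (i < m)%N -> (L i * defect F (dirsumZ_gen i) <= #|` F|)%N.
Proof.
move=> im; set T := [fset x in F | (dirsumZ_gen i * x)%g \notin F]%fset.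
(* The generator raises only coordinate [i], so the box can be left only from its top face. *)
have top x : x \in T -> in_box L m x /\ zcoord x i = (L i)%:Z - 1.
  rewrite mem_fset_sep => /andP[/FP xF gxF]; split=> //.
  have := xF i; rewrite im => /andP[xi0 xiL].
  apply/eqP; apply: contraNT gxF => xi; apply/FP => n.
  have := xF n; rewrite zcoordM zcoord_gen.
  case: (eqVneq n i) => [->|_]; last by rewrite add0r.
  by rewrite im; lia.
pose s := [seq ((dirsumZ_gen i ^+ l)^-1 * x)%g | l <- iota 0 (L i), x <- T].
have us : uniq s.
  apply: allpairs_uniq; rewrite ?iota_uniq ?fset_uniq//.
  move=> _ _ /allpairsP[[l x] /= [_ xT ->]] /allpairsP[[l' x'] /= [_ xT' ->]] /= E.
  (* Coordinate [i] of the translate is [L i - 1 - l], which determines [l]. *)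
  have El : l = l'.
    have /= := congr1 (zcoord^~ i) E.
    rewrite !zcoordM !zcoordV !zcoord_genX eqxx (top x xT).2 (top x' xT').2; lia.
  by congr pair => //; move: E; rewrite El => /mulgI.
rewrite -[X in (X * _)%N](size_iota 0).
rewrite -(size_allpairs (fun l x => (dirsumZ_gen i ^+ l)^-1 * x)%g).
rewrite uniq_leq_size//.
move=> _ /allpairsP[[l x] /= [lL /top[xB xi] ->]]; apply/FP => n.
move: lL; rewrite mem_iota add0n => /andP[_ lL].
have := xB n; rewrite zcoordM zcoordV zcoord_genX.
case: (eqVneq n i) => [->|_]; last by rewrite mul0n oppr0 add0r.
by rewrite im xi; lia.
Qed.

(** With side 1, coordinate [i] is 0 throughout the box, so the generator moves every element
    out. *)
Lemma box_defect_flat i : (i < m)%N -> L i = 1%N -> defect F (dirsumZ_gen i) = #|` F|.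
Proof.
move=> im Li; congr #|` _|; apply/fsetP => x; rewrite mem_fset_sep.
case xF: (x \in F) => //=; apply/negP => /FP/(_ i).
move/FP: xF => /(_ i); rewrite zcoordM zcoord_gen im Li eqxx; lia.
Qed.
End BoxDefect.
End DirectSum.

(** * Computing canonical indices of boxes *)

Section BoxCode.
Variables (nu : nat -> dirsumZ) (mul : nat -> nat -> nat) (e : nat) (gen : nat -> nat).
Hypotheses (nu_inj : injective nu) (nu_surj : forall g, exists n, nu n = g).
Hypothesis nuM : forall i j, nu (mul i j) = (nu i * nu j)%g.
Hypothesis nu1 : nu e = 1%g.
Hypothesis nu_gen : forall n, nu (gen n) = dirsumZ_gen n.

Definition gen_pow i l := prim e (fun _ z => mul (gen i) z) l.

Lemma nu_gen_pow i l : nu (gen_pow i l) = (dirsumZ_gen i ^+ l)%g.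
Proof.
elim: l => [|l IH]; first by rewrite expg0.
by rewrite /gen_pow primS nuM nu_gen IH expgS.
Qed.

(* Canonical index of the set of translates of the set coded by y by the first
   L powers of the i-th generator; the translates have to be disjoint. *)
Definition extend_code L i y :=
  \sum_(0 <= l < L) \sum_(0 <= x < y) nbit x y * 2 ^ mul (gen_pow i l) x.

(** The start [2 ^ e] codes the singleton of the identity, the box with no directions. *)
Definition box_code (L : nat -> nat) m :=
  prim (2 ^ e) (fun i y => extend_code (L i) i y) m.

(** Coordinate [m] vanishes on the box of the first [m] directions, so its translates by distinct
    powers of generator [m] are disjoint and the powers of 2 add up without carries. *)
Lemma box_codeP L m z : nbit z (box_code L m) <-> in_box L m (nu z).
Proof.
elim: m z => [|m IH] z.
  rewrite /box_code /= -(big_seq1 addn e (expn 2)) nbit_sum// inE.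
  split=> [/eqP-> n|zB]; first by rewrite nu1 zcoord1.
  apply/eqP/nu_inj; rewrite nu1; apply: zcoord_inj => n.
  by rewrite zcoord1; apply/eqP: (zB n).
rewrite /box_code primS -/(box_code _ _); set y := box_code L m in IH *.
have -> : extend_code (L m) m y =
    \sum_(w <- [seq mul (gen_pow m l) x | l <- iota 0 (L m), x <- code_set y]) 2 ^ w.
  rewrite big_allpairs_dep /extend_code /index_iota subn0.
  by apply: eq_bigr => l _; rewrite big_code_set /index_iota subn0.
have coordE l x n : zcoord (nu (mul (gen_pow m l) x)) n =
    (((n == m) * l)%N%:Z + zcoord (nu x) n)%R.
  by rewrite nuM nu_gen_pow zcoordM zcoord_genX.
have y0 x : x \in code_set y -> zcoord (nu x) m = 0%R.
  by rewrite in_code_set => /IH/(_ m); rewrite ltnn => /eqP.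
rewrite nbit_sum; last first.
  apply: allpairs_uniq; rewrite ?iota_uniq ?fset_uniq//.
  move=> _ _ /allpairsP[[l x] /= [_ xT ->]] /allpairsP[[l' x'] /= [_ xT' ->]] /= E.
  have El : l = l'.
    have := congr1 (fun w => zcoord (nu w) m) E.
    by rewrite !coordE eqxx !y0//; lia.
  by congr pair => //; move/(congr1 nu): E; rewrite El !nuM => /mulgI/nu_inj.
split=> [/allpairsP[[l x] /= [lL xy ->]] n|zB].
  move: lL; rewrite mem_iota add0n => /andP[_ lL]; rewrite coordE.
  have := xy; rewrite in_code_set => /IH/(_ n).
  case: (eqVneq n m) => [->|nm]; first by rewrite ltnSn ltnn y0//; lia.
  by rewrite mul0n GRing.add0r ltnS (leq_eqVlt n m) (negPf nm).
have := zB m; rewrite ltnSn => /andP[z0 zL].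
(* The coordinate is nonnegative, so [absz] recovers it; dividing out this power of the generator
   lands in the smaller box. *)
pose l := absz (zcoord (nu z) m).
have [x xE] := nu_surj ((dirsumZ_gen m ^+ l)^-1 * nu z)%g.
apply/allpairsP; exists (l, x); split=> /=.
- by rewrite mem_iota; lia.
- rewrite in_code_set; apply/IH => n; rewrite xE zcoordM zcoordV zcoord_genX.
  have := zB n; rewrite ltnS (leq_eqVlt n m); case: (eqVneq n m) => [->|nm /=].
    by rewrite ltnn; lia.
  by rewrite mul0n GRing.oppr0 GRing.add0r.
by apply: nu_inj; rewrite nuM nu_gen_pow xE mulVKg.
Qed.

Lemma rec_gen_pow : rec 2 (fun s => mul s#0 s#1) -> rec 1 (fun s => gen s#0) ->
  rec 2 (fun s => gen_pow s#0 s#1).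
Proof.
move=> rM rg; apply: (rec_prim (g := fun _ z s => mul (gen s#0) z)).
- exact: rec_const.
- apply: (rec_app2 rM); last exact: rec_nth.
  by apply: (rec_app1 rg); apply: rec_behead2.
- exact: rec_nth.
Qed.

Lemma rec_extend_code : rec 2 (fun s => mul s#0 s#1) -> rec 1 (fun s => gen s#0) ->
  rec 3 (fun s => extend_code s#0 s#1 s#2).
Proof.
move=> rM /(rec_gen_pow rM) rp; rewrite /extend_code.
repeat first [rec_step | by [] | lazymatch goal with
  | |- rec _ (fun s => mul (@?a s) (@?b s)) => apply: (rec_app2 rM)
  | |- rec _ (fun s => gen_pow (@?a s) (@?b s)) => apply: (rec_app2 rp)
  | |- rec _ (fun s => nat_of_bool (nbit (@?a s) (@?b s))) => apply: rec_nbit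
  end].
Qed.
End BoxCode.

Lemma rec_candidate (Q : nat -> nat -> nat -> nat -> bool) :
  rec 4 (fun s => Q s#0 s#1 s#2 s#3) ->
  rec 3 (fun s => candidate (Q s#0 s#1) s#2).
Proof.
move=> rQ; rewrite /candidate.
by repeat first [rec_step | by []
  | apply: (rec_app4 (f := fun m a b c => nat_of_bool (Q m a b c)) rQ)].
Qed.

(** * The many-one reduction to the index set *)

Section Hardness.
Variables (R : realType) (phi : nat -> nat -> option nat).
Hypothesis phi_universal : universal phi.
Variable nu : nat -> dirsumZ.
Hypothesis nu_std : standard_presentation nu.

Lemma indices_hard A : Pi03 A ->
  many_one_reducible A (effective_folner_indices R nu phi).
Proof.
move=> [P [chi rchi chiP] AP]; have [cG [gen rgen nu_gen]] := nu_std.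
have [mul nuM rM] := computable_mul cG; have [nuS nuI _] := cG.
have [e nu1] := nuS 1%g; move/recursive1_rec: rgen => rgen.
pose Q m a b c := chi [tuple m; a; b; c].
have rQ : rec 4 (fun s => Q s#0 s#1 s#2 s#3).
  apply: (proj1 (recursive_rec _) rchi) => v; congr (chi _ : nat).
  by apply: val_inj; case: v => -[|? [|? [|? [|? []]]]].
have {chiP}AQ m : A m <-> forall a, exists b, forall c, Q m a b c.
  rewrite AP; split=> H a; have [b bP] := H a; exists b => c; exact/chiP/bP.
pose side m a j := if candidate (Q m a) j == candidate (Q m a) j.+1 then j.+1 else 1.
have side_gt0 m a j : 0 < side m a j by rewrite /side; case: ifP.
pose psi m j := box_code mul e gen (side m ^~ j) j.
have rside : rec 3 (fun s => side s#0 s#1 s#2).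
  have rc := rec_candidate rQ.
  apply: rec_if; last exact: rec_const.
    apply: rec_eq; first exact: rc.
    by apply: (rec_app3 (f := fun m a j => candidate (Q m a) j) rc); repeat rec_step.
  by repeat rec_step.
have rpsi : rec 2 (fun s => psi s#0 s#1).
  apply: (rec_prim (g := fun i y s => extend_code mul e gen (side s#0 i s#1) i y)).
  - exact: rec_const.
  - apply: (rec_app3 (rec_extend_code e rM rgen)); try exact: rec_nth.
    by apply: (rec_app3 rside); repeat rec_step.
  - exact: rec_nth.
have [rphi phiU] := phi_universal.
(* Universality supplies the reduction: [s m] is an index of [psi m], recursively in [m]. *)
have [|s rs sE] := phiU (fun m j => Some (psi m j)).
  by apply/(recursive_rec (g := fun s => psi s#0 s#1)) => // v; rewrite !(tnth_nth 0).
exists s => // m; rewrite AQ.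
pose F j := [fset nu x | x in code_set (psi m j)]%fset.
have FP j g : g \in F j <-> in_box (side m ^~ j) j g.
  have [x <-] := nuS g; rewrite /F mem_imfset//= in_code_set.
  exact: box_codeP.
split=> [Qm|[n nE [rn [F' nF' /folnerP[_ Finv]]]] a].
- exists (psi m); first by move=> j; rewrite sE.
  split.
    apply/recursive1_rec.
    by apply: (rec_app2 (f := psi) rpsi (rec_const 1 m)); exact: rec_nth.
  exists (code_set \o psi m) => [j|]; first by rewrite /= code_setK.
  apply/folnerP; split=> [j|].
    apply/fset0Pn; exists 1%g; exact/(FP j)/in_box1.
  apply: almost_invariant_gens => a k.
  have /candidate_stabilizes[J JP] := Qm a.
  (* Past [J] the side is [j.+1], past [k] it is at least [k.+1], and past [a] the box extends in
     direction [a]. *)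
  exists (maxn (maxn J k) a.+1) => j; rewrite !geq_max => /andP[/andP[Jj kj] aj].
  apply: leq_trans (box_defect_le (FP j) aj).
  by rewrite /side JP// eqxx leq_mul2r ltnS kj orbT.
(* Precision 1 makes twice the defect at most the cardinality, which fails for a non-empty box of
   side 1 in direction [a]. *)
apply/candidate_stabilizes; have [N NF] := Finv (dirsumZ_gen a) 1.
exists (maxn N a.+1) => j; rewrite geq_max => /andP[Nj aj].
apply/eqP; apply: contraT => ne.
have FE : [fset nu x | x in F' j]%fset = F j.
  by rewrite /F; have := nE j; rewrite sE nF' => -[->]; rewrite canonical_indexK.
have := NF j Nj; rewrite FE (box_defect_flat (FP j) aj) ?/side ?(negPf ne)//.
have : 0 < #|` F j|.
  rewrite cardfs_gt0; apply/fset0Pn; exists 1%g; exact/(FP j)/in_box1.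
lia.
Qed.
End Hardness.

Theorem theorem5p1 (R : realType) (phi : nat -> nat -> option nat)
    (phi_universal : universal phi) :
  (forall (G : groupType) (nu : nat -> G), computable_group nu ->
     Pi03 (effective_folner_indices R nu phi)) /\
  (forall nu : nat -> dirsumZ, standard_presentation nu ->
     Pi03_complete (effective_folner_indices R nu phi)).
Proof.
have [rphi _] := phi_universal.
split=> [G nu|nu nu_std]; first exact: Pi03_indices.
split; first by apply: Pi03_indices => //; case: nu_std.
by move=> A; apply: indices_hard.
Qed.
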